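(* Let $S$ be epsilon-strongly graded by a group $G$ and put $R=S_e$. (1) If $R$ is semisimple and $1\in \mathrm{tr}_\gamma(Z(R)_{\rm fin})$, then $S$ is semisimple. (2) If $R$ is left (respectively right) hereditary, $1\in\mathrm{tr}_\gamma(Z(R)_{\rm fin})$, and every $S_g$, for $g\in G$, is projective as a left (respectively right) $R$-module, then $S$ is left (respectively right) hereditary. In particular: (3) If $R$ is semisimple, $\epsilon_g=0$ for all but finitely many $g\in G$, and $\mathrm{tr}_\gamma(1)$ is invertible in $R$, then $S$ is semisimple. (4) If $R$ is left (respectively right) hereditary, $\epsilon_g=0$ for all but finitely many $g\in G$, $\mathrm{tr}_\gamma(1)$ is invertible in $R$, and every $S_g$, for $g\in G$, is projective as a left (respectively right) $R$-module, then $S$ is left (respectively right) hereditary.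
   Context: Rings are associative with a nonzero multiplicative identity $1$. $Z(R)$ denotes the center of $R$. For additive subgroups $X,Y\subseteq S$, $XY$ denotes the set of finite sums of products $xy$ with $x\in X$, $y\in Y$. Let $G$ be a group with identity $e$. $S$ is graded by $G$ if there are additive subgroups $S_g\subseteq S$ ($g\in G$) with $S=\bigoplus_{g\in G}S_g$ and $S_gS_h\subseteq S_{gh}$ for all $g,h\in G$; $R=S_e$. An ideal of $R$ is called unital if it has its own multiplicative identity element (allowed to be $0$). $S$ is epsilon-strongly graded by $G$ if for each $g\in G$, $S_gS_{g^{-1}}$ is a unital ideal of $R$, and for all $g,h\in G$ the equalities $S_gS_h = S_gS_{g^{-1}}S_{gh} = S_{gh}S_{h^{-1}}S_h$ hold. Then $\epsilon_g$ denotes the multiplicative identity element of $S_gS_{g^{-1}}$. For each $g\in G$ fix $n_g\in\{1,2,\ldots\}$ and elements $u_g^{(i)}\in S_g$, $v_{g^{-1}}^{(i)}\in S_{g^{-1}}$, $1\le i\le n_g$, with $\sum_{i=1}^{n_g}u_g^{(i)}v_{g^{-1}}^{(i)}=\epsilon_g$ (with $n_e=1$, $u_e^{(1)}=v_e^{(1)}=1$), and define $\gamma_g:S\to S$ by $\gamma_g(s)=\sum_{i=1}^{n_g}u_g^{(i)}sv_{g^{-1}}^{(i)}$. (On $Z(R)$, $\gamma_g$ does not depend on the choices and takes values in $Z(R)$.) $Z(R)_{\rm fin}$ is the set of $r\in Z(R)$ such that $r\epsilon_g=0$ for all but finitely many $g\in G$, and $\mathrm{tr}_\gamma:Z(R)_{\rm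 fin}\to Z(R)$ is $\mathrm{tr}_\gamma(r)=\sum_{g\in G}\gamma_g(r)$. A ring is semisimple if all its left modules (equivalently, all its right modules) are semisimple. A ring is left (right) hereditary if all submodules of projective left (right) modules over it are projective. *)

(* Defs.v *)
From HB Require Import structures.
From mathcomp Require Import all_boot all_algebra.
From mathcomp Require Import boolp classical_sets functions cardinality fsbigop.

Set Implicit Arguments.
Unset Strict Implicit.
Unset Printing Implicit Defensive.

Import GRing.Theory.

Local Open Scope classical_set_scope.
Local Open Scope ring_scope.

(* A right module over R is a left module over the converse ring R^c: every   *)
(* right-handed notion below is the left-handed one taken over R^c.           *)

Record submodule (R : nzRingType) (M : lmodType R) (N : submodClosed M) :=
  Submodule { submodule_val :> M; submodule_valP : submodule_val \in N }.

HB.instance Definition _ R M N := [isSub for @submodule_val R M N].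
HB.instance Definition _ R M N := [Choice of @submodule R M N by <:].
HB.instance Definition _ R M N :=
  [SubChoice_isSubLmodule of @submodule R M N by <:].

Definition semisimple_module (R : nzRingType) (M : lmodType R) : Prop :=
  forall N : submodClosed M, exists N' : submodClosed M,
    (forall x, x \in N -> x \in N' -> x = 0) /\
    (forall x, exists y z, [/\ y \in N, z \in N' & x = y + z]).

Definition semisimple_ring (R : nzRingType) : Prop :=
  forall M : lmodType R, semisimple_module M.

Definition projective (R : nzRingType) (P : lmodType R) : Prop :=
  forall (M N : lmodType R) (p : {linear M -> N}) (f : {linear P -> N}),
    (forall y, exists x, p x = y) ->
    exists h : {linear P -> M}, forall x, p (h x) = f x.

Arguments projective : clear implicits.

Definition left_hereditary (R : nzRingType) : Prop :=
  forall (P : lmodType R) (N : submodClosed P),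
    projective R P -> projective R (submodule N).

Definition right_hereditary (R : nzRingType) : Prop := left_hereditary R^c.

(* The last field says that S is the internal direct sum of the components. *)
Record grading (G : groupType) (S : nzRingType) := Grading {
  component :> G -> zmodClosed S;
  componentM : forall g h x y,
    x \in component g -> y \in component h -> x * y \in component (g * h)%g;
  component_direct_sum : forall s, exists! c : G -> S,
    [/\ forall g, c g \in component g,
        finite_set [set g | c g != 0]
      & s = \sum_(g \in [set: G]) c g]
}.

Section PrincipalComponent.
Variables (G : groupType) (S : nzRingType) (A : grading G S).

Lemma fsum_mull (a : S) (c : G -> S) : finite_set [set g | c g != 0] ->
  a * (\sum_(g \in [set: G]) c g) = \sum_(g \in [set: G]) a * c g.
Proof.
move=> finc; apply: full_fsbig_distrr.
by apply: sub_finite_set finc => g [_ /eqP].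
Qed.

Lemma component1 : 1 \in A 1%g.
Proof.
have [c [[cA finc e1] _]] := component_direct_sum A 1.
have mulc1 h s : s \in A h -> s * c 1%g = s.
  move=> sA; have [d [_ duniq]] := component_direct_sum A s.
  pose c1 k := s * c (h^-1 * k)%g.
  pose c2 k : S := if k == h then s else 0.
  have c1P : d = c1.
    apply: duniq; split.
    - move=> k; have := componentM sA (cA (h^-1 * k)%g).
      by rewrite mulgA mulgV mul1g.
    - apply: (@sub_finite_set _ _ ((fun g => h * g)%g @` [set g | c g != 0])).
        move=> k /= c1k; exists (h^-1 * k)%g; last by rewrite mulgA mulgV mul1g.
        by apply: contra_neq c1k; rewrite /c1 => ->; rewrite mulr0.
      exact: finite_image.
    - rewrite -[LHS]mulr1 {1}e1 (fsum_mull s finc).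
      rewrite [RHS](reindex_fsbigT (fun g => h * g)%g).
        by apply: eq_fsbigr => g _; rewrite /c1 mulgA mulVg mul1g.
      exists (fun g => h^-1 * g)%g => g /=.
        by rewrite mulgA mulVg mul1g.
      by rewrite mulgA mulgV mul1g.
  have c2P : d = c2.
    apply: duniq; split.
    - by move=> k; rewrite /c2; case: eqP => [->//|_]; exact: rpred0.
    - apply: (@sub_finite_set _ _ [set h]); last exact: finite_set1.
      by move=> k /=; rewrite /c2; case: (k =P h) => [->//|_]; rewrite eqxx.
    - rewrite -(@fsbig_widen _ _ _ _ [set h]) ?fsbig_set1 /c2 ?eqxx//.
      by move=> k [_ /= kh]; rewrite /preimage /=; case: eqP.
  have /(congr1 (fun f => f h)) : c1 = c2 by rewrite -c1P -c2P.
  by rewrite /c1 /c2 eqxx mulVg.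
have -> : 1 = c 1%g; last exact: cA.
rewrite -[RHS]mul1r [in RHS]e1 [in LHS]e1.
rewrite (big_distrl (c 1%g)) /=.
by apply: eq_bigr => g _; rewrite (mulc1 g).
Qed.

Lemma component1_subring : subring_closed (A 1%g).
Proof.
split; first exact: component1; first exact: rpredB.
by move=> x y xA yA; have := componentM xA yA; rewrite mulg1.
Qed.

Record principal := Principal {
  principal_val :> S; principal_valP : principal_val \in A 1%g }.

HB.instance Definition _ := [isSub for principal_val].
HB.instance Definition _ := [Choice of principal by <:].
HB.instance Definition _ :=
  GRing.SubChoice_isSubNzRing.Build S (mem (A 1%g)) principal component1_subring.

End PrincipalComponent.

Section ComponentModules.
Variables (G : groupType) (S : nzRingType) (A : grading G S) (g : G).

Lemma component_mull (r : principal A) (x : S) : x \in A g -> val r * x \in A g.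
Proof. by move=> xA; have := componentM (valP r) xA; rewrite mul1g. Qed.

Lemma component_mulr (r : principal A) (x : S) : x \in A g -> x * val r \in A g.
Proof. by move=> xA; have := componentM xA (valP r); rewrite mulg1. Qed.

(* Two copies of the g-component: one with its left, one with its right module *)
(* structure over the principal component.                                    *)
Record lcomponent := LComponent {
  lcomponent_val :> S; lcomponent_valP : lcomponent_val \in A g }.

HB.instance Definition _ := [isSub for lcomponent_val].
HB.instance Definition _ := [Choice of lcomponent by <:].
HB.instance Definition _ := [SubChoice_isSubZmodule of lcomponent by <:].

Definition lcomponent_scale (r : principal A) (x : lcomponent) : lcomponent :=
  LComponent (component_mull r (valP x)).

Fact lcomponent_scaleA r s x :
  lcomponent_scale r (lcomponent_scale s x) = lcomponent_scale (r * s) x.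
Proof. by apply: val_inj; rewrite /= mulrA. Qed.
Fact lcomponent_scale1 : left_id 1 lcomponent_scale.
Proof. by move=> x; apply: val_inj; rewrite /= mul1r. Qed.
Fact lcomponent_scaleDr : right_distributive lcomponent_scale +%R.
Proof. by move=> r x y; apply: val_inj; rewrite /= mulrDr. Qed.
Fact lcomponent_scaleDl x : {morph lcomponent_scale^~ x : r s / r + s}.
Proof. by move=> r s; apply: val_inj; rewrite /= mulrDl. Qed.

HB.instance Definition _ := GRing.Zmodule_isLmodule.Build (principal A)
  lcomponent lcomponent_scaleA lcomponent_scale1
  lcomponent_scaleDr lcomponent_scaleDl.

Record rcomponent := RComponent {
  rcomponent_val :> S; rcomponent_valP : rcomponent_val \in A g }.

HB.instance Definition _ := [isSub for rcomponent_val].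
HB.instance Definition _ := [Choice of rcomponent by <:].
HB.instance Definition _ := [SubChoice_isSubZmodule of rcomponent by <:].

Definition rcomponent_scale (r : (principal A)^c) (x : rcomponent) :
  rcomponent := RComponent (component_mulr r (valP x)).

Fact rcomponent_scaleA r s x :
  rcomponent_scale r (rcomponent_scale s x) = rcomponent_scale (r * s) x.
Proof. by apply: val_inj; rewrite /= mulrA. Qed.
Fact rcomponent_scale1 : left_id 1 rcomponent_scale.
Proof. by move=> x; apply: val_inj; rewrite /= mulr1. Qed.
Fact rcomponent_scaleDr : right_distributive rcomponent_scale +%R.
Proof. by move=> r x y; apply: val_inj; rewrite /= mulrDl. Qed.
Fact rcomponent_scaleDl x : {morph rcomponent_scale^~ x : r s / r + s}.
Proof. by move=> r s; apply: val_inj; rewrite /= mulrDr. Qed.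

HB.instance Definition _ := GRing.Zmodule_isLmodule.Build (principal A)^c
  rcomponent rcomponent_scaleA rcomponent_scale1
  rcomponent_scaleDr rcomponent_scaleDl.

End ComponentModules.

(* Finite sums of products, not just products. *)
Definition mulset (S : nzRingType) (X Y : set S) : set S :=
  [set s | exists n (x y : 'I_n -> S),
     [/\ forall i, X (x i), forall i, Y (y i) & s = \sum_i x i * y i]].

Definition identity_of (S : nzRingType) (I : set S) (e : S) : Prop :=
  I e /\ forall x, I x -> e * x = x /\ x * e = x.

Section EpsilonStrong.
Variables (G : groupType) (S : nzRingType) (A : grading G S).

Definition compset (g : G) : set S := [set x | x \in A g].

Definition ideal_of_principal (I : set S) : Prop :=
  [/\ I `<=` compset 1%g,
      I 0,
      forall x y, I x -> I y -> I (x - y)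
    & forall r x, compset 1%g r -> I x -> I (r * x) /\ I (x * r)].

Definition unital_ideal (I : set S) : Prop :=
  ideal_of_principal I /\ exists e, identity_of I e.

Definition epsilon_strongly_graded : Prop :=
  (forall g, unital_ideal (mulset (compset g) (compset g^-1%g))) /\
  (forall g h,
     mulset (compset g) (compset h) =
       mulset (mulset (compset g) (compset g^-1%g)) (compset (g * h)%g) /\
     mulset (compset g) (compset h) =
       mulset (mulset (compset (g * h)%g) (compset h^-1%g)) (compset h)).

(* Identities being unique, this is the identity as soon as there is one. *)
Definition epsilon (g : G) : S :=
  xget 0 [set e | identity_of (mulset (compset g) (compset g^-1%g)) e].

(* [gamma_v g i] has degree g^-1: it stands for v_{g^-1}^{(i)}. *)
Record gamma_data := GammaData {
  gamma_n : G -> nat;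
  gamma_u : forall g, 'I_(gamma_n g) -> S;
  gamma_v : forall g, 'I_(gamma_n g) -> S;
  gamma_n_gt0 : forall g, (0 < gamma_n g)%N;
  gamma_uP : forall g (i : 'I_(gamma_n g)), gamma_u i \in A g;
  gamma_vP : forall g (i : 'I_(gamma_n g)), gamma_v i \in A g^-1%g;
  gamma_sum : forall g, \sum_(i < gamma_n g) gamma_u i * gamma_v i = epsilon g;
  gamma_n1 : gamma_n 1%g = 1%N;
  gamma_u1 : forall i : 'I_(gamma_n 1%g), gamma_u i = 1;
  gamma_v1 : forall i : 'I_(gamma_n 1%g), gamma_v i = 1
}.

Definition gamma (D : gamma_data) (g : G) (s : S) : S :=
  \sum_(i < gamma_n D g) gamma_u i * s * gamma_v i.

(* The center of the principal component, not of S. *)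
Definition principal_center : set S :=
  [set r | compset 1%g r /\ forall x, compset 1%g x -> r * x = x * r].

Definition principal_center_fin : set S :=
  [set r | principal_center r /\ finite_set [set g | r * epsilon g != 0]].

(* Meaningful on [principal_center_fin], where the sum has finite support; a  *)
(* sum of infinite support would be 0.                                        *)
Definition gamma_trace (D : gamma_data) (r : S) : S :=
  \sum_(g \in [set: G]) gamma D g r.

Definition invertible_in_principal (s : S) : Prop :=
  compset 1%g s /\ exists t, [/\ compset 1%g t, s * t = 1 & t * s = 1].

End EpsilonStrong.

(* Main.v *)
Require Import Defs.
From HB Require Import structures.
From mathcomp Require Import all_boot all_algebra.
From mathcomp Require Import boolp classical_sets functions cardinality fsbigop.

Set Implicit Arguments.
Unset Strict Implicit.
Unset Printing Implicit Defensive.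

Import GRing.Theory.

Local Open Scope classical_set_scope.
Local Open Scope ring_scope.

(** The four assertions are instances of one fact: the ring extension S / R,
    with R = S_e, is separable as soon as some c in Z(R)_fin has trace 1.
    The element

      e_c  =  sum_g sum_i  u_g^(i) c (x) v_{g^-1}^(i)    in   S (x)_R S

    multiplies to tr_gamma(c) = 1, and s e_c = e_c s for every s.  For s of
    degree h the second claim is a computation that sends the summand of
    degree g to the one of degree hg: s u_g has degree hg, so it is unchanged by
    epsilon_hg = sum_i u_hg v_hg on its left, and the coefficient v_hg s u_g
    that appears has degree e, hence commutes with c and slides through the
    tensor sign ([trace_term_shift], [trace_separable]).  All but finitely many
    summands vanish because v_{g^-1} = epsilon_{g^-1} v_{g^-1}.

    A separability element turns any R-linear map f between S-modules into an
    S-linear one, x |-> sum a f(b x) over the pairs (a, b) ([average_linear]),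
    and keeps the properties of f that matter, as in Maschke's theorem
    ([average_eq]).  Averaging an R-linear projection onto an S-submodule
    gives semisimplicity ([separable_semisimple]); averaging an R-linear lift
    shows that an S-module which is projective over R is projective over S
    ([separable_projective]).

    For heredity one also descends: if S is projective over R, then a projective
    S-module P is projective over R ([projective_restrict]).  Indeed R-linear
    maps P -> N are S-linear maps P -> Hom_R(S, N), and Hom_R(S, -) preserves
    surjections because S is projective.  So an S-submodule of P is
    projective over R when R is hereditary, and then projective over S.  Here S
    is the direct sum of the S_g, hence projective if they all are
    ([projective_direct_sum]).

    Separability is left-right symmetric ([separable_converse]), so right-handed
    statements follow from left-handed ones over the converse rings.

    Finally, if almost all epsilon_g vanish, then T = tr_gamma(1) is the sum of
    the epsilon_g.  It is central in S, because s epsilon_h = epsilon_gh s for s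
    of degree g.  If T has an inverse t in R, then t is central too and
    tr_gamma(t) = t T = 1 ([trace1_invertible]). *)

(** * Submodules, linear maps and finitely supported sums *)

Lemma submodClosed_of_prop (R : nzRingType) (M : lmodType R) (P : M -> Prop) :
    P 0 -> (forall a x y, P x -> P y -> P (a *: x + y)) ->
  exists N : submodClosed M, forall x, x \in N <-> P x.
Proof.
move=> P0 PD; pose Q : {pred M} := fun x => `[< P x >].
have QE x : x \in Q <-> P x by split=> /asboolP.
have QP : submod_closed Q.
  by split=> [|a x y /QE Px /QE Py]; apply/QE; last exact: PD.
pose QB := GRing.isSubmodClosed.Build R M Q QP.
pose N : submodClosed M := HB.pack Q QB.
by exists N.
Qed.

Lemma submodClosedB (R : nzRingType) (M : lmodType R) (N : submodClosed M) x y :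
  x \in N -> y \in N -> x - y \in N.
Proof. by move=> xN yN; rewrite -scaleN1r; apply: rpredD => //; apply: rpredZ. Qed.

Lemma linear_of_prop (R : nzRingType) (M N : lmodType R) (f : M -> N) :
  linear f -> exists g : {linear M -> N}, g =1 f.
Proof.
move=> lf; pose fB := GRing.isLinear.Build R M N *:%R f lf.
pose g : {linear M -> N} := HB.pack f fB.
by exists g.
Qed.

(** Sums of several families whose supports lie in one finite set are compared
    through a common list of indices, which does not depend on the families or
    on the group where they take their values. *)
Lemma fsum_finite (I : choiceType) (B : set I) : finite_set B ->
  exists r : seq I, forall (V : nmodType) (F : I -> V),
    (forall i, F i != 0 -> B i) -> \sum_(i \in [set: I]) F i = \sum_(i <- r) F i.
Proof.
move=> Bfin; have [r [ur BE]] : exists r : seq I, uniq r /\ B = [set` r].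
  have [r ->] := (finite_seqP B).1 Bfin.
  exists (undup r); split; first exact: undup_uniq.
  by apply/seteqP; split=> i /=; rewrite mem_undup.
exists r => V F FB; rewrite [RHS]fsbig_seq// -BE; apply/esym/fsbig_widen => //.
by move=> i [_ nBi] /=; apply: contra_notP nBi => /eqP /FB.
Qed.

(** * Projective modules *)

Section Projective.
Variables (R : nzRingType).

Lemma projective_retract (P Q : lmodType R) (i : {linear P -> Q})
    (q : {linear Q -> P}) :
  cancel i q -> projective R Q -> projective R P.
Proof.
move=> iK projQ M N p f psurj.
have [h ph] := projQ M N p (f \o q) psurj.
by exists (h \o i) => x /=; rewrite ph /= iK.
Qed.

(** The coordinates of x are linear in x, as they are unique; so the lifts of
    the restrictions to the summands add up to a linear lift. *)
Lemma projective_direct_sum (I : choiceType) (P : lmodType R)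
    (Q : I -> lmodType R) (j : forall i, {linear Q i -> P}) :
    (forall x, exists! c : forall i, Q i,
       finite_set [set i | c i != 0] /\ x = \sum_(i \in [set: I]) j i (c i)) ->
  (forall i, projective R (Q i)) -> projective R P.
Proof.
move=> Pdec projQ M N p f psurj.
have hP i := cid (projQ i M N p (f \o j i) psurj).
pose h i := sval (hP i); have ph i x : p (h i x) = f (j i x) := svalP (hP i) x.
have [c cP] := choice Pdec.
have cfin x : finite_set [set i | c x i != 0] by case: (cP x) => -[].
have cE x : x = \sum_(i \in [set: I]) j i (c x i) by case: (cP x) => -[].
have cuniq x (d : forall i, Q i) : finite_set [set i | d i != 0] ->
    x = \sum_(i \in [set: I]) j i (d i) -> c x = d.
  by move=> dfin dE; case: (cP x) => _; apply.
have finsum (B : set I) : finite_set B -> exists r : seq I,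
    forall (W : lmodType R) (k : forall i, {linear Q i -> W})
      (d : forall i, Q i),
    (forall i, d i != 0 -> B i) ->
    \sum_(i \in [set: I]) k i (d i) = \sum_(i <- r) k i (d i).
  move=> /fsum_finite[r rP]; exists r => W k d dB; apply: rP => i ki0.
  by apply: dB; apply: contra_neq ki0 => ->; rewrite linear0.
have supp_comb a x y : [set i | a *: c x i + c y i != 0] `<=`
    [set i | c x i != 0] `|` [set i | c y i != 0].
  move=> i /= cxy0; have [cx0|] := eqVneq (c x i) 0; last by left.
  by right; rewrite cx0 scaler0 add0r in cxy0.
have supp_fin x y : finite_set ([set i | c x i != 0] `|` [set i | c y i != 0]).
  by rewrite finite_setU; split.
have sum_comb (W : lmodType R) (k : forall i, {linear Q i -> W}) a x y :
    \sum_(i \in [set: I]) k i (a *: c x i + c y i) =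
    a *: \sum_(i \in [set: I]) k i (c x i) + \sum_(i \in [set: I]) k i (c y i).
  have [r rP] := finsum _ (supp_fin x y).
  rewrite (rP W k (c x)); last by move=> i ?; left.
  rewrite (rP W k (c y)); last by move=> i ?; right.
  rewrite (rP W k _ (supp_comb a x y)) scaler_sumr -big_split/=.
  by apply: eq_bigr => i _; rewrite linearP.
have cZD a x y : c (a *: x + y) = fun i => a *: c x i + c y i.
  apply: cuniq; first exact: sub_finite_set (supp_comb a x y) (supp_fin x y).
  by rewrite sum_comb -!cE.
have hlin : linear (fun x => \sum_(i \in [set: I]) h i (c x i)).
  by move=> a x y; rewrite cZD sum_comb.
have [H HE] := linear_of_prop hlin.
exists H => x; rewrite HE [in RHS](cE x).
have [r rP] := finsum _ (cfin x).
rewrite !rP// !raddf_sum; apply: eq_bigr => i _; exact: ph.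
Qed.
End Projective.

(** * Restriction of scalars *)

(** The type records [iota], so that the R-module structure can be inferred
    from it. *)
Definition restrict (R S : nzRingType) (iota : {rmorphism R -> S})
  (M : lmodType S) : Type := M.

Section Restriction.
Variables (R S : nzRingType) (iota : {rmorphism R -> S}).

Section RestrictedModule.
Variable M : lmodType S.

HB.instance Definition _ := GRing.Zmodule.on (restrict iota M).

Definition restrict_scale (r : R) (x : restrict iota M) : restrict iota M :=
  iota r *: (x : M).

Fact restrict_scaleA r s x :
  restrict_scale r (restrict_scale s x) = restrict_scale (r * s) x.
Proof. by rewrite /restrict_scale scalerA rmorphM. Qed.
Fact restrict_scale1 : left_id 1 restrict_scale.
Proof. by move=> x; rewrite /restrict_scale rmorph1 scale1r. Qed.
Fact restrict_scaleDr : right_distributive restrict_scale +%R.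
Proof. by move=> r x y; exact: scalerDr. Qed.
Fact restrict_scaleDl x : {morph restrict_scale^~ x : r s / r + s}.
Proof. by move=> r s; rewrite /restrict_scale rmorphD scalerDl. Qed.

HB.instance Definition _ := GRing.Zmodule_isLmodule.Build R (restrict iota M)
  restrict_scaleA restrict_scale1 restrict_scaleDr restrict_scaleDl.

Lemma restrict_scaleE (r : R) (x : restrict iota M) :
  r *: x = iota r *: (x : M) :> M.
Proof. by []. Qed.

End RestrictedModule.

Lemma restrict_linear (M N : lmodType S) (f : {linear M -> N}) :
  exists g : {linear restrict iota M -> restrict iota N}, g =1 f.
Proof. by apply: linear_of_prop => r x y; exact: linearP. Qed.

Lemma restrict_submod (M : lmodType S) (N : submodClosed M) :
  exists N' : submodClosed (restrict iota M),
    forall x : M, (x \in N') = (x \in N).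
Proof.
have [||N' N'E] := @submodClosed_of_prop R (restrict iota M) (fun x => (x : M) \in N).
- exact: rpred0.
- by move=> r x y xN yN; apply: rpredD => //; exact: rpredZ.
by exists N' => x; apply/idP/idP => /N'E.
Qed.

End Restriction.

(** * Coinduced modules and descent of projectivity *)

Section Coinduction.
Variables (R S : nzRingType) (iota : {rmorphism R -> S}).

Section CoinducedModule.
Variable M : lmodType R.

Definition base_linear : {pred (S -> M)} :=
  fun f => `[< forall r x y, f (iota r * x + y) = r *: f x + f y >].

Fact base_linear_zmod_closed : zmod_closed base_linear.
Proof.
split=> [|f g /asboolP fP /asboolP gP]; apply/asboolP => r x y.
  by rewrite scaler0 addr0.
by rewrite !fctE fP gP scalerBr opprD addrACA.
Qed.

HB.instance Definition _ :=
  GRing.isZmodClosed.Build (S -> M) base_linear base_linear_zmod_closed.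

(** The S-module Hom_R(S, M), where s acts on f by x |-> f (x s). *)
Record coinduced := Coinduced {
  coinduced_val :> S -> M; coinduced_valP : coinduced_val \in base_linear }.

HB.instance Definition _ := [isSub for coinduced_val].
HB.instance Definition _ := [Choice of coinduced by <:].
HB.instance Definition _ := [SubChoice_isSubZmodule of coinduced by <:].

Lemma coinduced_linear (f : coinduced) r x y :
  f (iota r * x + y) = r *: f x + f y.
Proof. by have /asboolP := valP f. Qed.

Lemma coinducedD (f : coinduced) x y : f (x + y) = f x + f y.
Proof.
by have := coinduced_linear f 1 x y; rewrite rmorph1 mul1r scale1r.
Qed.

Lemma coinducedZ (f : coinduced) r x : f (iota r * x) = r *: f x.
Proof.
apply: (addIr (f 0)).
by rewrite -coinducedD addr0 -coinduced_linear addr0.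
Qed.

Fact translate_subproof (s : S) (f : coinduced) :
  (fun x => f (x * s)) \in base_linear.
Proof.
by apply/asboolP => r x y; rewrite mulrDl -mulrA coinduced_linear.
Qed.

Definition translate s f := Coinduced (translate_subproof s f).

Fact translateA r s f : translate r (translate s f) = translate (r * s) f.
Proof. by apply/val_inj/funext => x /=; rewrite mulrA. Qed.
Fact translate1 : left_id 1 translate.
Proof. by move=> f; apply/val_inj/funext => x /=; rewrite mulr1. Qed.
Fact translateDr : right_distributive translate +%R.
Proof. by move=> s f g; apply/val_inj/funext => x. Qed.
Fact translateDl f : {morph translate^~ f : r s / r + s}.
Proof.
move=> r s; apply/val_inj/funext => x /=.
by rewrite mulrDr coinducedD.
Qed.

HB.instance Definition _ := GRing.Zmodule_isLmodule.Build S coinduced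
  translateA translate1 translateDr translateDl.

End CoinducedModule.

(** Hom_R(S, -) is right adjoint to restriction of scalars, and exact when S is
    projective over R; so restriction preserves projectivity. *)
Lemma projective_restrict (P : lmodType S) :
    projective R (restrict iota S^o) ->
  projective S P -> projective R (restrict iota P).
Proof.
move=> projS projP M N p f psurj.
(* [q] is Hom_R(S, p), and [F] is the adjunct of [f]. *)
have [q qE] : exists q : {linear coinduced M -> coinduced N},
    forall (a : coinduced M) x, q a x = p (a x).
  have pL (a : coinduced M) : (fun x => p (a x)) \in @base_linear N.
    by apply/asboolP => r x y; rewrite coinduced_linear linearP.
  have [|q qE] := @linear_of_prop _ _ _ (fun a => Coinduced (pL a)).
    by move=> s a b; apply/val_inj/funext => x /=; rewrite raddfD.
  by exists q => a x; rewrite qE.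
have [F FE] : exists F : {linear P -> coinduced N},
    forall x s, F x s = f (s *: x).
  have fL (x : P) : (fun s : S => f (s *: x) : N) \in @base_linear N.
    apply/asboolP => r s t; rewrite scalerDl -scalerA.
    exact: (linearP f r (s *: x) (t *: x)).
  have [|F FE] := @linear_of_prop _ _ _ (fun x => Coinduced (fL x)).
    move=> s x y; apply/val_inj/funext => t /=.
    by rewrite scalerDr scalerA; exact: (raddfD f).
  by exists F => x s; rewrite FE.
have qsurj b : exists a, q a = b.
  have [|g gE] := @linear_of_prop _ (restrict iota S^o) N b.
    by move=> r x y; exact: coinduced_linear.
  have [a aE] := projS M N p g psurj.
  have aL : (a : S -> M) \in @base_linear M.
    by apply/asboolP => r x y; exact: (linearP a r x y).
  by exists (Coinduced aL); apply/val_inj/funext => x /=; rewrite qE /= aE gE.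
have [h hE] := projP _ _ q F qsurj.
have hlin : linear (fun x : restrict iota P => h x 1).
  move=> r x y; rewrite restrict_scaleE linearP /= -coinducedZ mulr1.
  by rewrite -[in RHS](mul1r (iota r)).
have [H HE] := linear_of_prop hlin.
by exists H => x; rewrite HE -qE hE FE scale1r.
Qed.
End Coinduction.

(** * Separable ring extensions and averaging *)

Section Separable.
Variables (R S : nzRingType).

Definition balanced (iota : R -> S) (V : zmodType) (B : S -> S -> V) :=
  [/\ forall x x' y, B (x + x') y = B x y + B x' y,
      forall x y y', B x (y + y') = B x y + B x y'
    & forall r x y, B (x * iota r) y = B x (iota r * y)].

(** The list [e] stands for the tensor sum of p.1 (x) p.2 in S (x)_R S.  Equations
    in that group are stated through its universal property, by evaluating all
    balanced maps. *)
Definition separability_element (iota : R -> S) (e : seq (S * S)) : Prop :=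
  \sum_(p <- e) p.1 * p.2 = 1 /\
  forall (V : zmodType) (B : S -> S -> V), balanced iota B ->
    forall s, \sum_(p <- e) B (s * p.1) p.2 = \sum_(p <- e) B p.1 (p.2 * s).

Definition separable (iota : R -> S) : Prop :=
  exists e, separability_element iota e.

Definition average (e : seq (S * S)) (M N : lmodType S) (f : M -> N) (x : M) : N :=
  \sum_(p <- e) p.1 *: f (p.2 *: x).

(** Under the hypothesis each summand a q(f(b x)) is a b q(f x), and the a b add
    up to 1.  With q = id and x in an S-submodule that f fixes, the average fixes
    x as well; with f an R-linear lift through q, the average is again a lift. *)
Lemma average_eq (e : seq (S * S)) (M N P : lmodType S) (f : M -> N)
    (q : {linear N -> P}) (x : M) :
    \sum_(p <- e) p.1 * p.2 = 1 ->
    (forall s, q (f (s *: x)) = s *: q (f x)) ->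
  q (average e f x) = q (f x).
Proof.
move=> e1 qfx; rewrite linear_sum -[RHS]scale1r -e1 scaler_suml.
by apply: eq_bigr => p _; rewrite linearZ_LR qfx scalerA.
Qed.

Variable iota : {rmorphism R -> S}.

(** For fixed x, the map (a, b) |-> a f(b x) is balanced since f is R-linear;
    moving s across the separability element is then S-linearity. *)
Lemma average_linear (e : seq (S * S)) (M N : lmodType S)
    (f : {linear restrict iota M -> restrict iota N}) :
  separability_element iota e -> linear (average e (f : M -> N)).
Proof.
move=> [_ eB] s x y; rewrite /average.
have -> : s *: (\sum_(p <- e) p.1 *: (f (p.2 *: x) : N)) =
    \sum_(p <- e) p.1 *: (f ((p.2 * s) *: x) : N).
  pose B (a b : S) : N := a *: (f (b *: x) : N).
  rewrite -(eB N B); last split.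
  - by rewrite scaler_sumr; apply: eq_bigr => p _; rewrite scalerA.
  - by move=> a a' b; exact: scalerDl.
  - by move=> a b b'; rewrite /B scalerDl (raddfD f); exact: scalerDr.
  - move=> r a b; rewrite /B -!scalerA; congr (a *: _).
    exact/esym/(linearZ_LR f r (b *: x)).
rewrite -big_split/=; apply: eq_bigr => p _.
by rewrite scalerDr scalerA (raddfD f); exact: scalerDr.
Qed.

Lemma separable_projective (P : lmodType S) :
  separable iota -> projective R (restrict iota P) -> projective S P.
Proof.
move=> [e eP] projP M N p f psurj.
have [p' p'E] := restrict_linear iota p.
have [f' f'E] := restrict_linear iota f.
have [h hE] : exists h : {linear restrict iota P -> restrict iota M},
    forall x, p' (h x) = f' x.
  by apply: projP => y; have [x <-] := psurj y; exists x; exact: p'E.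
have {}hE x : p (h x) = f x by rewrite -p'E hE f'E.
have [H HE] := linear_of_prop (average_linear h eP).
exists H => x; rewrite HE average_eq ?hE//; first by case: eP.
by move=> s; rewrite !hE linearZ.
Qed.

(** Maschke's argument: average an R-linear projection onto N, and take the
    kernel of the average as complement. *)
Lemma separable_semisimple :
  separable iota -> semisimple_ring R -> semisimple_ring S.
Proof.
move=> [e eP] ssR M N.
have [NR NRE] := restrict_submod iota N.
have [C [NC0 NCD]] := ssR _ NR.
have /choice [f fP] (x : restrict iota M) :
    exists y : restrict iota M, y \in NR /\ x - y \in C.
  have [y [z [yN zC ->]]] := NCD x.
  by exists y; rewrite addrC addKr.
have funiq x y : y \in NR -> x - y \in C -> f x = y.
  move=> yN xyC; have [fN fC] := fP x.
  apply/subr0_eq/NC0; first exact: submodClosedB.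
  have -> : f x - y = (x - y) - (x - f x) by rewrite opprB [RHS]addrC subrKA.
  exact: submodClosedB.
have flin : linear f.
  move=> r x y; have [fxN fxC] := fP x; have [fyN fyC] := fP y.
  apply: funiq; first by apply: rpredD => //; exact: rpredZ.
  by rewrite opprD addrACA -scalerBr; apply: rpredD => //; exact: rpredZ.
(* [F] is the projection onto N along the R-complement [C]. *)
have [F FE] := linear_of_prop flin.
have [pi piE] := linear_of_prop (average_linear F eP).
have piN x : pi x \in N.
  rewrite piE; apply: rpred_sum => p _; apply: rpredZ.
  by rewrite -NRE FE; case: (fP (p.2 *: x)).
have FN x : x \in N -> F x = x.
  by move=> xN; rewrite FE; apply: funiq; rewrite ?NRE// subrr; exact: rpred0.
have pi_id x : x \in N -> pi x = x.
  move=> xN; rewrite piE -[LHS]/(idfun (average e F x)).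
  rewrite average_eq /= ?FN//; first by case: eP.
  by move=> s; rewrite FN// rpredZ.
have [||K KE] := @submodClosed_of_prop S M (fun x => pi x = 0).
- exact: linear0.
- by move=> s x y x0 y0; rewrite linearP x0 y0 scaler0 addr0.
exists K; split=> [x xN /KE|x]; first by rewrite pi_id.
exists (pi x), (x - pi x); split; first exact: piN.
- by apply/KE; rewrite linearB /= (pi_id (pi x))// subrr.
- by rewrite addrC subrK.
Qed.

Lemma projective_restrict_submod (P : lmodType S) (N : submodClosed P) :
    (forall N' : submodClosed (restrict iota P), projective R (submodule N')) ->
  projective R (restrict iota (submodule N)).
Proof.
have [NR NRE] := restrict_submod iota N => /(_ NR).
have inNR (x : submodule N) : (val x : restrict iota P) \in NR.
  by rewrite NRE; exact: valP.
have inN (x : submodule NR) : (val x : P) \in N by rewrite -NRE; exact: valP.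
have [i iE] : exists i : {linear restrict iota (submodule N) -> submodule NR},
    i =1 fun x => Submodule (inNR x).
  by apply: linear_of_prop => r x y; apply: val_inj.
have [q qE] : exists q : {linear submodule NR -> restrict iota (submodule N)},
    q =1 fun x => Submodule (inN x).
  by apply: linear_of_prop => r x y; apply: val_inj.
by apply: (@projective_retract _ _ _ i q) => x; rewrite qE; apply: val_inj; rewrite /= iE.
Qed.

Lemma separable_hereditary :
    separable iota -> projective R (restrict iota S^o) ->
  left_hereditary R -> left_hereditary S.
Proof.
move=> sepS projS hR P N projP.
apply: separable_projective => //; apply: projective_restrict_submod => N'.
by apply: hR; exact: projective_restrict.
Qed.

End Separable.

(** * Converse rings *)

Section Converse.
Variables (R S : nzRingType) (iota : {rmorphism R -> S}).

Let iota_converse : R^c -> S^c := iota.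

HB.instance Definition _ := GRing.isNmodMorphism.Build R^c S^c iota_converse
  (raddf0 iota, raddfD iota).
Fact iota_converse_monoid : monoid_morphism iota_converse.
Proof. by split=> [|x y]; [exact: (rmorph1 iota) | exact: (rmorphM iota y x)]. Qed.
HB.instance Definition _ := GRing.isMonoidMorphism.Build R^c S^c
  iota_converse iota_converse_monoid.

Definition converse_morphism : {rmorphism R^c -> S^c} := iota_converse.

(** The swap a (x) b |-> b (x) a preserves separability elements. *)
Lemma separable_converse : separable iota -> separable converse_morphism.
Proof.
move=> [e [e1 eB]]; exists [seq (p.2, p.1) | p <- e]; split.
  by rewrite big_map.
move=> V B [Bl Br Bm] s; rewrite !big_map /=.
rewrite -(eB V (fun x y => B y x))//; split=> // r x y.
exact/esym/(Bm r y x).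
Qed.
End Converse.

(** * Epsilon-strong gradings *)

Section Graded.
Variables (G : groupType) (S : nzRingType) (A : grading G S).

Lemma homogeneous_ind (P : S -> Prop) :
    P 0 -> (forall x y, P x -> P y -> P (x + y)) ->
  (forall g x, x \in A g -> P x) -> forall s, P s.
Proof.
move=> P0 PD PA s; have [c [[cA cfin ->] _]] := component_direct_sum A s.
have [r ->//] := fsum_finite cfin.
by apply: big_ind => // g _; exact: PA (cA g).
Qed.

Lemma mulset_mem (X Y : set S) x y : X x -> Y y -> mulset X Y (x * y).
Proof.
by move=> Xx Yy; exists 1, (fun=> x), (fun=> y); split=> //; rewrite big_ord1.
Qed.

Lemma mulset_id_l (X Y : set S) e :
  (forall x, X x -> e * x = x) -> forall z, mulset X Y z -> e * z = z.
Proof.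
move=> eX _ [n [x [y [Xx Yy ->]]]]; rewrite mulr_sumr.
by apply: eq_bigr => i _; rewrite mulrA eX.
Qed.

(** The bracketing is that of S_g S_{g^-1} S_g in the definition of the grading,
    while a right identity is known for the product of the last two factors. *)
Lemma mulset_id_r (X Y Z : set S) e :
    (forall y, mulset Y Z y -> y * e = y) ->
  forall z, mulset (mulset X Y) Z z -> z * e = z.
Proof.
move=> eYZ _ [n [w [z [XYw Zz ->]]]]; rewrite mulr_suml.
apply: eq_bigr => i _; have [m [x [y [Xx Yy ->]]]] := XYw i.
rewrite !mulr_suml; apply: eq_bigr => j _; rewrite -!mulrA.
by rewrite [y j * _]mulrA eYZ//; exact: mulset_mem.
Qed.

Hypothesis hA : epsilon_strongly_graded A.

Lemma epsilonP g :
  identity_of (mulset (compset A g) (compset A g^-1%g)) (epsilon A g).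
Proof. by have [_ /(xgetPex 0)] := hA.1 g. Qed.

Lemma epsilon_principal g : epsilon A g \in A 1%g.
Proof. by have [[+ _ _ _] _] := hA.1 g; apply; case: (epsilonP g). Qed.

Lemma component_mulset g x : x \in A g ->
  mulset (mulset (compset A g) (compset A g^-1%g)) (compset A g) x.
Proof.
move=> xA; have := (hA.2 g 1%g).1; rewrite mulg1 => <-.
rewrite -[x]mulr1; apply: mulset_mem => //; exact: component1.
Qed.

Lemma epsilon_mul g x : x \in A g -> epsilon A g * x = x.
Proof.
move=> /component_mulset; apply: mulset_id_l => y.
by case: (epsilonP g) => _ eP /eP[].
Qed.

Lemma mul_epsilonV g x : x \in A g -> x * epsilon A g^-1%g = x.
Proof.
move=> /component_mulset; apply: mulset_id_r => y.
by have [_ eP] := epsilonP g^-1%g; rewrite invgK in eP; move=> /eP[].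
Qed.

Lemma mul_epsilon g x : x \in A g^-1%g -> x * epsilon A g = x.
Proof. by move=> /mul_epsilonV; rewrite invgK. Qed.

(** Both sides equal epsilon_gh s epsilon_h: the products s epsilon_h and
    epsilon_gh s lie in S_gh S_{h^-1}, which has epsilon_gh as left and
    epsilon_h as right identity. *)
Lemma epsilon_twist g h s : s \in A g -> s * epsilon A h = epsilon A (g * h)%g * s.
Proof.
move=> sA; transitivity (epsilon A (g * h)%g * s * epsilon A h).
  have [[n [x [y [xA yA ->]]]] _] := epsilonP h.
  rewrite -mulrA !mulr_sumr; apply: eq_bigr => i _.
  by rewrite !mulrA -[_ * s * x i]mulrA epsilon_mul//; exact: componentM (xA i).
have [[n [x [y [xA yA ->]]]] _] := epsilonP (g * h)%g.
rewrite !mulr_suml; apply: eq_bigr => i _.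
rewrite -!mulrA; congr (x i * _); rewrite mulrA mul_epsilon//.
by have := componentM (yA i) sA; rewrite invgM mulgVK.
Qed.

Variable D : gamma_data A.

Definition principal_inclusion : {rmorphism principal A -> S} := val.

(** * The trace and separability *)

Section Trace.
Variables (c : S).
Hypothesis cP : principal_center A c.

Section Balanced.
Variables (V : zmodType) (B : S -> S -> V).
Hypothesis balB : balanced principal_inclusion B.

(** The image under [B] of s e_g t, where e_g is the summand of degree g of the
    candidate separability element. *)
Definition trace_term g (s t : S) : V :=
  \sum_(i < gamma_n D g) B (s * (gamma_u i * c)) (gamma_v i * t).

Lemma balanced_suml I (r : seq I) (F : I -> S) y :
  B (\sum_(i <- r) F i) y = \sum_(i <- r) B (F i) y.
Proof.
have [Bl _ _] := balB; apply: (big_morph (B^~ y)) => //.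
by apply: (addrI (B 0 y)); rewrite -Bl !addr0.
Qed.

Lemma balanced_sumr I (r : seq I) (F : I -> S) x :
  B x (\sum_(i <- r) F i) = \sum_(i <- r) B x (F i).
Proof.
have [_ Br _] := balB; apply: (big_morph (B x)) => //.
by apply: (addrI (B x 0)); rewrite -Br !addr0.
Qed.

Lemma balanced_principal z x y : z \in A 1%g -> B (x * z) y = B x (z * y).
Proof. by move=> zA; have [_ _ /(_ (Principal zA))] := balB; apply. Qed.

Lemma trace_term_eq0 g s t :
  c * epsilon A g^-1%g = 0 -> trace_term g s t = 0.
Proof.
move=> c0; apply: big1 => i _; rewrite -(epsilon_mul (gamma_vP i)) -mulrA.
rewrite -balanced_principal ?epsilon_principal// -!mulrA c0 !mulr0.
have [Bl _ _] := balB.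
by apply: (addrI (B 0 (gamma_v i * t))); rewrite -Bl !addr0.
Qed.

(** Insert epsilon_hg = sum_i u_hg v_hg on the left of s u_g; the factor
    v_hg s u_g has degree e, so it commutes with c and crosses to the other
    argument of [B], where the u_g v_g add up to epsilon_g. *)
Lemma trace_term_shift g h s : s \in A h ->
  trace_term g s 1 = trace_term (h * g)%g 1 s.
Proof.
move=> sA; have [cA cC] := cP; rewrite /trace_term.
transitivity (\sum_(j < gamma_n D g) \sum_(i < gamma_n D (h * g)%g)
    B (gamma_u i * c) (gamma_v i * s * (gamma_u j * gamma_v j))).
  apply: eq_bigr => j _; rewrite mulr1.
  have suA : s * gamma_u j \in A (h * g)%g by apply: componentM => //; exact: gamma_uP.
  rewrite mulrA -(epsilon_mul suA) -(gamma_sum D) !mulr_suml balanced_suml.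
  apply: eq_bigr => i _.
  have vsuA : gamma_v i * (s * gamma_u j) \in A 1%g.
    by have := componentM (gamma_vP i) suA; rewrite mulVg.
  rewrite -[X in X * c]mulrA -[_ * _ * c]mulrA -cC// mulrA balanced_principal//.
  by rewrite !mulrA.
rewrite exchange_big/=; apply: eq_bigr => i _; rewrite mul1r.
rewrite -balanced_sumr -mulr_sumr gamma_sum mul_epsilon//.
by have := componentM (gamma_vP i) sA; rewrite invgM mulgVK.
Qed.

End Balanced.

Lemma trace_separable :
  finite_set [set g | c * epsilon A g != 0] -> gamma_trace D c = 1 ->
  separable principal_inclusion.
Proof.
move=> cfin trc.
pose supp := [set g | c * epsilon A g^-1%g != 0].
have suppfin : finite_set supp.
  apply: sub_finite_set (finite_image (fun g => g^-1%g) cfin) => g /= c0.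
  by exists g^-1%g => //; rewrite invgK.
have [r rP] := fsum_finite suppfin.
have sumE (V : zmodType) (B : S -> S -> V) s t : balanced principal_inclusion B ->
    \sum_(g <- r) trace_term B g s t = \sum_(g \in [set: G]) trace_term B g s t.
  move=> balB; rewrite rP// => g; apply: contra_neq => c0.
  exact: trace_term_eq0.
pose e := [seq (gamma_u i * c, gamma_v i) | g <- r, i <- enum 'I_(gamma_n D g)].
have eE (V : zmodType) (F : S * S -> V) :
    \sum_(p <- e) F p =
    \sum_(g <- r) \sum_(i < gamma_n D g) F (gamma_u i * c, gamma_v i).
  by rewrite big_allpairs_dep; apply: eq_bigr => g _; rewrite big_enum.
exists e; split.
  rewrite eE -trc /gamma_trace.
  have balM : balanced principal_inclusion (fun x y : S => x * y).
    split=> [x x' y|x y y'|z x y]; first exact: mulrDl; first exact: mulrDr.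
    by rewrite mulrA.
  have := sumE _ _ 1 1 balM; rewrite /trace_term.
  under eq_bigr do under eq_bigr do rewrite mul1r mulr1.
  move=> ->; apply: eq_fsbigr => g _; apply: eq_bigr => i _.
  by rewrite mul1r mulr1.
move=> V B balB; have [Bl Br _] := balB.
apply: homogeneous_ind => [|x y IHx IHy|h s sA].
- apply: eq_bigr => p _; rewrite mul0r mulr0.
  by rewrite -[RHS](addrK (B p.1 0)) -[LHS](addrK (B 0 p.2)) -Bl -Br !addr0 !subrr.
- transitivity (\sum_(p <- e) (B (x * p.1) p.2 + B (y * p.1) p.2)).
    by apply: eq_bigr => p _; rewrite mulrDl Bl.
  rewrite big_split/= IHx IHy -big_split/=.
  by apply: eq_bigr => p _; rewrite mulrDr Br.
rewrite !eE /=.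
transitivity (\sum_(g <- r) trace_term B g s 1).
  by apply: eq_bigr => g _; apply: eq_bigr => i _; rewrite mulr1.
transitivity (\sum_(g <- r) trace_term B g 1 s); last first.
  by apply: eq_bigr => g _; apply: eq_bigr => i _; rewrite mul1r.
rewrite !sumE// [RHS](reindex_fsbigT (fun g => h * g)%g).
  by apply: eq_fsbigr => g _; exact: trace_term_shift.
by exists (fun g => h^-1 * g)%g => g /=; rewrite ?mulKg ?mulVKg.
Qed.

End Trace.

Lemma gamma1 g : gamma D g 1 = epsilon A g.
Proof. by rewrite -(gamma_sum D); apply: eq_bigr => i _; rewrite mulr1. Qed.

(** The trace of 1 is the sum of all epsilon_h, and a homogeneous s permutes these
    by [epsilon_twist]. *)
Lemma trace1_central s : finite_set [set g | epsilon A g != 0] ->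
  gamma_trace D 1 * s = s * gamma_trace D 1.
Proof.
move=> efin; elim/homogeneous_ind: s => [|x y IHx IHy|h s sA].
- by rewrite mul0r mulr0.
- by rewrite mulrDl mulrDr IHx IHy.
have -> : gamma_trace D 1 = \sum_(g \in [set: G]) epsilon A g.
  by apply: eq_fsbigr => g _; exact: gamma1.
have [r rP] := fsum_finite efin.
rewrite (fsum_mull s efin) rP// mulr_suml.
transitivity (\sum_(g \in [set: G]) epsilon A g * s).
  by rewrite rP// => g; apply: contra_neq => ->; rewrite mul0r.
rewrite (reindex_fsbigT (fun g => h * g)%g).
  by apply: eq_fsbigr => g _; rewrite (epsilon_twist g sA).
by exists (fun g => h^-1 * g)%g => g /=; rewrite ?mulKg ?mulVKg.
Qed.

(** Take c to be the inverse t of tr_gamma(1): it is central in S, hence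
    gamma_g(t) = t gamma_g(1). *)
Lemma trace1_invertible :
    finite_set [set g | epsilon A g != 0] ->
    invertible_in_principal A (gamma_trace D 1) ->
  (gamma_trace D @` principal_center_fin A) 1.
Proof.
move=> efin [TA [t [tA Tt tT]]].
have tC s : t * s = s * t.
  rewrite -[s in LHS]mulr1 -Tt [s * _]mulrA -trace1_central// mulrA.
  by rewrite mulrA tT mul1r.
exists t.
  split; first by split=> // x _; exact: tC.
  by apply: sub_finite_set efin => g /=; apply: contra_neq => ->; rewrite mulr0.
rewrite -tT /gamma_trace fsum_mull; last first.
  by apply: sub_finite_set efin => g /=; rewrite gamma1.
apply: eq_fsbigr => g _; rewrite /gamma mulr_sumr.
by apply: eq_bigr => i _; rewrite -tC mulr1 mulrA.
Qed.

(** * Projectivity over the principal component *)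

(** The copies Q g of the components are arbitrary, so that the left and the
    right module structures that the components carry are treated at once. *)
Lemma component_decomposition (Q : G -> zmodType)
    (k : forall g, {additive Q g -> S}) :
    (forall g, injective (k g)) -> (forall g q, k g q \in A g) ->
    (forall g x, x \in A g -> exists q, k g q = x) ->
  forall s, exists! d : forall g, Q g,
    finite_set [set g | d g != 0] /\ s = \sum_(g \in [set: G]) k g (d g).
Proof.
move=> kinj kA kQ s.
have [c [[cA cfin sE] cuniq]] := component_direct_sum A s.
have dP g := cid (kQ g (c g) (cA g)).
pose d g := sval (dP g); have dE g : k g (d g) = c g := svalP (dP g).
exists d; split.
  split; last by rewrite sE; apply: eq_fsbigr => g _; rewrite dE.
  by apply: sub_finite_set cfin => g /=; rewrite -dE (raddf_eq0 _ (kinj g)).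
move=> d' [d'fin sE']; have cE : c = fun g => k g (d' g).
  apply: cuniq; split=> //.
  by apply: sub_finite_set d'fin => g /=; rewrite (raddf_eq0 _ (kinj g)).
by apply: functional_extensionality_dep => g; apply: kinj; rewrite dE cE.
Qed.

Lemma projective_over_principal :
    (forall g, projective (principal A) (lcomponent A g)) ->
  projective (principal A) (restrict principal_inclusion S^o).
Proof.
have jP g := cid (@linear_of_prop _ (lcomponent A g)
  (restrict principal_inclusion S^o) val (fun _ _ _ => erefl)).
pose j g := sval (jP g); have jE g x : j g x = val x := svalP (jP g) x.
apply: (projective_direct_sum (j := j)).
apply: (component_decomposition (k := j)) => g.
- by move=> x y; rewrite /= !jE => /val_inj.
- by move=> x; rewrite /= jE; exact: valP.
- by move=> x xA; exists (LComponent xA); rewrite /= jE.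
Qed.

Lemma projective_over_principal_converse :
    (forall g, projective (principal A)^c (rcomponent A g)) ->
  projective (principal A)^c
    (restrict (converse_morphism principal_inclusion) (S^c)^o).
Proof.
have jP g := cid (@linear_of_prop _ (rcomponent A g)
  (restrict (converse_morphism principal_inclusion) (S^c)^o) val
  (fun _ _ _ => erefl)).
pose j g := sval (jP g); have jE g x : j g x = val x := svalP (jP g) x.
apply: (projective_direct_sum (j := j)).
apply: (component_decomposition (k := j)) => g.
- by move=> x y; rewrite /= !jE => /val_inj.
- by move=> x; rewrite /= jE; exact: valP.
- by move=> x xA; exists (RComponent xA); rewrite /= jE.
Qed.

End Graded.

(** * Semisimplicity and heredity *)

Theorem theorem23 (G : groupType) (S : nzRingType) (A : grading G S)
    (hA : epsilon_strongly_graded A) (D : gamma_data A) :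
  (semisimple_ring (principal A) ->
   (gamma_trace D @` principal_center_fin A) 1 ->
   semisimple_ring S) /\
  ((left_hereditary (principal A) ->
    (gamma_trace D @` principal_center_fin A) 1 ->
    (forall g, projective (principal A) (lcomponent A g)) ->
    left_hereditary S) /\
   (right_hereditary (principal A) ->
    (gamma_trace D @` principal_center_fin A) 1 ->
    (forall g, projective (principal A)^c (rcomponent A g)) ->
    right_hereditary S)) /\
  (semisimple_ring (principal A) ->
   finite_set [set g | epsilon A g != 0] ->
   invertible_in_principal A (gamma_trace D 1) ->
   semisimple_ring S) /\
  ((left_hereditary (principal A) ->
    finite_set [set g | epsilon A g != 0] ->
    invertible_in_principal A (gamma_trace D 1) ->
    (forall g, projective (principal A) (lcomponent A g)) ->
    left_hereditary S) /\
   (right_hereditary (principal A) ->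
    finite_set [set g | epsilon A g != 0] ->
    invertible_in_principal A (gamma_trace D 1) ->
    (forall g, projective (principal A)^c (rcomponent A g)) ->
    right_hereditary S)).
Proof.
have sep c : gamma_trace D c = 1 -> principal_center_fin A c ->
    separable (principal_inclusion A).
  by move=> trc [cC cfin]; exact: (trace_separable hA cC cfin trc).
have ss : semisimple_ring (principal A) ->
    (gamma_trace D @` principal_center_fin A) 1 -> semisimple_ring S.
  by move=> ssR [c cfin /sep/(_ cfin) sepS]; exact: separable_semisimple sepS ssR.
have lh : left_hereditary (principal A) ->
    (gamma_trace D @` principal_center_fin A) 1 ->
    (forall g, projective (principal A) (lcomponent A g)) -> left_hereditary S.
  move=> hR [c cfin /sep/(_ cfin) sepS] /projective_over_principal projS.
  exact: separable_hereditary sepS projS hR.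
have rh : right_hereditary (principal A) ->
    (gamma_trace D @` principal_center_fin A) 1 ->
    (forall g, projective (principal A)^c (rcomponent A g)) ->
    right_hereditary S.
  move=> hR [c cfin /sep/(_ cfin) sepS] /projective_over_principal_converse projS.
  exact: separable_hereditary (separable_converse sepS) projS hR.
have tr1 := trace1_invertible hA.
split; first exact: ss.
split; first by split; [exact: lh | exact: rh].
split; first by move=> ssR efin /(tr1 D efin); exact: ss.
split=> [hR efin /(tr1 D efin) tr projA|hR efin /(tr1 D efin) tr projA].
  exact: lh.
exact: rh.
Qed.
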